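(* Let $N\ge1$ and let $R_{1/2}$ be the $N\times N$ matrix with entries $R_{1/2}(n,m)=\tfrac12(n+m-|n-m|)=\min(n,m)$, $1\le n,m\le N$, and $R_{1/2}^{\circ2}$ its entrywise square. Then the matrix $R_{1/2}^{-1}R_{1/2}^{\circ2}$ is upper triangular with eigenvalues $\{1,3,5,\ldots,2N-1\}$. In particular, $\kappa(1,N)=1$ for all $N\ge1$, where $\kappa(1,N)$ is the Bakry–Émery curvature of $-(-\Delta)^{1/2}$ on $\mathbb{T}=\mathbb{R}/(2\pi\mathbb{Z})$ restricted to $\mathcal{T}_N^+=\mathrm{span}_{\mathbb{C}}\{e^{inx}:1\le n\le N\}$.
   Context: $L_1=-(-\Delta)^{1/2}$ acts on $\mathbb{T}$ by $L_1(e^{inx})=-|n|e^{inx}$. Its sesquilinear carré du champ $\Gamma$ (linear in the first argument, conjugate-linear in the second) satisfies $\Gamma(e^{in\cdot},e^{im\cdot})(x)=e^{i(n-m)x}\,\tfrac12(|n|+|m|-|n-m|)$. The iterated carré du champ is $\Gamma_2(f,f)=\tfrac12\bigl[L_1(\Gamma(f,f))-\Gamma(f,L_1f)-\Gamma(L_1f,f)\bigr]$. The curvature $\kappa(1,N)$ is the largest real $\kappa$ such that $\Gamma_2(f,f)(x)\ge\kappa\,\Gamma(f,f)(x)$ for all $f\in\mathcal{T}_N^+$ and $x\in\mathbb{T}$. *)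

(* Defs.v *)
From HB Require Import structures.
From mathcomp Require Import all_boot all_order all_algebra.
From mathcomp Require Import complex.
From mathcomp Require Import all_classical all_reals all_analysis.
Import Order.TTheory GRing.Theory Num.Theory.
Import numFieldNormedType.Exports.

Set Implicit Arguments.
Unset Strict Implicit.
Unset Printing Implicit Defensive.

Local Open Scope classical_set_scope.
Local Open Scope ring_scope.
Local Open Scope complex_scope.

(* Functions on the torus R/(2 pi Z) are represented by functions R -> R[i]
   of the angle; all the functions used in the curvature condition below are
   trigonometric polynomials, hence 2 pi-periodic. *)

Definition expix (R : realType) (n : int) (x : R) : R[i] :=
  cos (n%:~R * x) +i* sin (n%:~R * x).

Definition fourier_coef (R : realType) (f : R -> R[i]) (n : int) : R[i] :=
  let g := fun x => f x * conjc (expix n x) in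
  ((2 * pi)^-1)%:C *
  ((\int[lebesgue_measure]_(x in `[0, 2 * pi]) complex.Re (g x)) +i*
   (\int[lebesgue_measure]_(x in `[0, 2 * pi]) complex.Im (g x))).

(* The operator -(-Delta)^{1/2}, i.e. the Fourier multiplier of symbol -|n|,
   as the pointwise limit of the symmetric partial sums over -K <= n <= K.
   The partial sums are eventually constant if f is a trigonometric
   polynomial. *)
Definition L1 (R : realType) (f : R -> R[i]) (x : R) : R[i] :=
  let S (K : nat) : R[i]^o :=
    \sum_(j < K.*2.+1)
      let n := j%:Z - K%:Z in - `|n|%:~R * fourier_coef f n * expix n x in
  lim (S @ \oo).

(* The sesquilinear carre du champ
     Gamma(f, g) = 1/2 [L1 (f g^* ) - f (L1 g)^* - (L1 f) g^* ],
   for which Gamma(e^{in.}, e^{im.})(x) = 1/2 (|n| + |m| - |n-m|) e^{i(n-m)x}. *)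
Definition Gamma (R : realType) (f g : R -> R[i]) (x : R) : R[i] :=
  2^-1 * (L1 (fun y => f y * conjc (g y)) x
          - f x * conjc (L1 g x) - L1 f x * conjc (g x)).

Definition Gamma2 (R : realType) (f : R -> R[i]) (x : R) : R[i] :=
  2^-1 * (L1 (Gamma f f) x - Gamma f (L1 f) x - Gamma (L1 f) f x).

(* The complex span of the functions e^{inx}, 1 <= n <= N. *)
Definition trig_plus (R : realType) (N : nat) : set (R -> R[i]) :=
  [set f | exists c : 'I_N -> R[i],
      f = fun x => \sum_(i < N) c i * expix i.+1%:Z x].

(* The order on R[i] compares numbers with equal imaginary parts; here both
   sides are real. *)
Definition curvature_bound (R : realType) (N : nat) (k : R) : Prop :=
  forall f : R -> R[i], trig_plus N f ->
  forall x : R, k%:C * Gamma f f x <= Gamma2 f x.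

Definition is_curvature (R : realType) (N : nat) (k : R) : Prop :=
  curvature_bound N k /\ forall k' : R, curvature_bound N k' -> k' <= k.

(* The index i : 'I_N stands for n = i + 1. *)
Definition Rhalf (R : realType) (N : nat) : 'M[R]_N :=
  \matrix_(i, j) (2^-1 * (i.+1%:R + j.+1%:R - `|i.+1%:R - j.+1%:R|)).

Definition hadamard_square (R : realType) (m n : nat) (A : 'M[R]_(m, n)) :
  'M[R]_(m, n) := map_mx (fun a => a ^+ 2) A.

(* Main.v *)
Require Import Defs.
From HB Require Import structures.
From mathcomp Require Import all_boot all_order all_algebra.
From mathcomp Require Import complex.
From mathcomp Require Import all_classical all_reals all_analysis.
From mathcomp Require Import ring zify.
Import Order.TTheory GRing.Theory Num.Theory.
Import numFieldNormedType.Exports.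
Local Open Scope complex_scope.
Local Open Scope ring_scope.

Set Implicit Arguments.
Unset Strict Implicit.
Unset Printing Implicit Defensive.

(** Everything follows from two ways of counting: min(m, n) is the number of
    k >= 1 with k <= m and k <= n, and its square is the sum of 2 k - 1 over the
    same k ([min_sum], [min_sqr_sum]).

    For matrices, this says that the kernel is [U^T U] and its entrywise square
    [U^T D U], where U is the unitriangular matrix of the step functions and D
    is diagonal with entries 1, 3, ..., 2 N - 1. The quotient is therefore
    [U^-1 D U]: it is upper triangular, and the odd numbers are on its diagonal
    ([Rhalf_quotient]).

    For the curvature, the orthogonality of the exponentials shows that L1 acts
    on finite sums of exponentials by its symbol ([L1_trig]). Gamma then has the
    symbol w(m, n) = (|m| + |n| - |m - n|) / 2 ([Gamma_trig]) and, for purely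
    algebraic reasons, Gamma2 has the symbol w(m, n)^2 ([Gamma2_trig]). For
    positive frequencies w is the minimum, so the two counting identities give,
    for f the sum of the c_n e^{inx},
      Gamma(f, f)(x) = sum_k |S_k|^2   and
      Gamma2(f, f)(x) = sum_k (2 k - 1) |S_k|^2,
    where S_k is the sum of c_n e^{inx} over n >= k ([Gamma_plus]). Every weight
    2 k - 1 is at least 1, hence the curvature is at least 1; the function
    e^{ix} has equality, hence it is exactly 1. *)

(** * Orthogonality of the exponentials *)

(** Continuity of the derivative is part of the notion because the
    fundamental theorem of calculus requires it. *)
Definition primitive_of (R : realType) (F f : R -> R) :=
  (forall x : R, is_derive x (1 : R) F (f x)) /\ continuous f.

(** Exhibiting one primitive of a whole trigonometric sum replaces the
    linearity of the integral, hence all integrability side conditions. *)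
Lemma primitive_of_sum (R : realType) (I : finType) (F f : I -> R -> R) :
  (forall i, primitive_of (F i) (f i)) ->
  primitive_of (\sum_i F i) (\sum_i f i).
Proof.
move=> Ff; apply: (big_ind2 (@primitive_of R)) => //.
- by split=> [x|]; [exact: is_derive_cst | exact: cst_continuous].
- move=> F1 f1 F2 f2 [dF1 cf1] [dF2 cf2]; split=> [x|x].
    by have dx1 := dF1 x; have dx2 := dF2 x; exact: is_deriveD.
  by apply: cvgD; [exact: cf1 | exact: cf2].
Qed.

Lemma Rintegral_primitive (R : realType) (F f : R -> R) (a b : R) :
  a < b -> primitive_of F f ->
  \int[lebesgue_measure]_(x in `[a, b]%classic) f x = F b - F a.
Proof.
move=> ab [dF cf].
have cF : continuous F.
  by move=> x; apply/differentiable_continuous/derivable1_diffP; case: (dF x).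
rewrite /Rintegral (@continuous_FTC2 R f F) //.
- exact: continuous_subspaceT.
- split; first by move=> x _; case: (dF x).
  + exact/cvg_at_right_filter/cF.
  + exact/cvg_at_left_filter/cF.
- by move=> x _; rewrite derive1E; apply: derive_val.
Qed.

(** The real part of [(a + i b) e^{ikx}]; its imaginary part is
    [harmonic b (- a) k x]. *)
Definition harmonic (R : realType) (a b : R) (k : int) (x : R) : R :=
  a * cos (k%:~R * x) - b * sin (k%:~R * x).

Definition harmonic_primitive (R : realType) (a b : R) (k : int) (x : R) : R :=
  if k == 0 then a * x
  else k%:~R^-1 * (a * sin (k%:~R * x) + b * cos (k%:~R * x)).

Lemma harmonicP (R : realType) (a b : R) (k : int) :
  primitive_of (harmonic_primitive a b k) (harmonic a b k).
Proof.
split=> x.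
  rewrite /harmonic_primitive /harmonic; case: eqVneq => [->|k0].
    apply: is_derive_eq; rewrite mul0r cos0 sin0 mulr0 mulr1 subr0.
    by rewrite /GRing.scale /= ?(mulr0, mulr1, add0r, addr0).
  apply: is_derive_eq; rewrite /GRing.scale /=.
  have k0' : (k%:~R : R) != 0 by rewrite intr_eq0.
  by field.
suff dh : derivable (harmonic a b k) x 1.
  exact/differentiable_continuous/derivable1_diffP.
by rewrite /harmonic; apply: ex_derive.
Qed.

Lemma expix_2pi (R : realType) (k : int) : expix k (2 * pi) = 1 :> R[i].
Proof.
have cosn n : cos (n%:R * (2 * pi)) = 1 :> R.
  rewrite (mulr_natl pi 2) mulr_natl -[_ *+ n]add0r.
  by rewrite periodicn ?cos0 //; exact: cosD2pi.
have sinn n : sin (n%:R * (2 * pi)) = 0 :> R.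
  rewrite (mulr_natl pi 2) mulr_natl -[_ *+ n]add0r.
  by rewrite periodicn ?sin0 //; exact: sinD2pi.
rewrite /expix; case: k => n; first by rewrite -pmulrn cosn sinn.
by rewrite NegzE mulrNz mulNr cosN sinN -pmulrn cosn sinn oppr0.
Qed.

Lemma expix_at0 (R : realType) (k : int) : expix k 0 = 1 :> R[i].
Proof. by rewrite /expix mulr0 cos0 sin0. Qed.

(** The primitive of a harmonic of nonzero frequency is itself periodic of
    period 2 pi, so only the terms of frequency 0 contribute. *)
Lemma Rintegral_harmonic_sum (R : realType) (I : finType) (a b : I -> R)
    (k : I -> int) (g : R -> R) :
  (forall x, g x = \sum_i harmonic (a i) (b i) (k i) x) ->
  \int[lebesgue_measure]_(x in `[0, 2 * pi]%classic) g x =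
  2 * pi * \sum_i a i * (k i == 0)%:R.
Proof.
move=> gE; pose F i := harmonic_primitive (a i) (b i) (k i).
pose f i := harmonic (a i) (b i) (k i).
have Ff : primitive_of (\sum_i F i) (\sum_i f i).
  by apply: primitive_of_sum => i; exact: harmonicP.
have pi2 : 0 < 2 * pi :> R by rewrite mulr_gt0 ?pi_gt0.
rewrite -[RHS]subr0 mulr_sumr.
have {gE} -> : g = \sum_i f i by apply/funext => x; rewrite fct_sumE gE.
rewrite (Rintegral_primitive pi2 Ff) !fct_sumE -!sumrB.
rewrite subr0; apply: eq_bigr => i _; rewrite /F /harmonic_primitive.
case: eqVneq => _; first by rewrite mulr0 subr0 mulr1 mulrC.
case: (expix_2pi R (k i)) => -> ->; rewrite !mulr0 cos0 sin0.
by ring.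
Qed.

(** * Trigonometric polynomials and the operator L1 *)

(** Frequencies may repeat, and the index type is arbitrary, so that the
    product of two trigonometric polynomials is again one, indexed by pairs,
    without collecting the terms of equal frequency. *)
Definition trig (R : realType) (I : finType) (c : I -> R[i]) (k : I -> int)
  (x : R) : R[i] := \sum_i c i * expix (k i) x.

Lemma expixD (R : realType) (m n : int) (x : R) :
  expix (m + n) x = expix m x * expix n x.
Proof.
rewrite /expix intrD mulrDl cosD sinD.
by apply/eqP; rewrite eq_complex /= eqxx /= addrC.
Qed.

Lemma expixN (R : realType) (n : int) (x : R) :
  expix (- n) x = conjc (expix n x).
Proof. by rewrite /expix mulrNz mulNr cosN sinN. Qed.

Lemma Re_sum (R : realType) (I : finType) (z : I -> R[i]) :
  complex.Re (\sum_i z i) = \sum_i complex.Re (z i).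
Proof. by apply: (big_morph (@complex.Re R)) => // -[? ?] [? ?]. Qed.

Lemma Im_sum (R : realType) (I : finType) (z : I -> R[i]) :
  complex.Im (\sum_i z i) = \sum_i complex.Im (z i).
Proof. by apply: (big_morph (@complex.Im R)) => // -[? ?] [? ?]. Qed.

Lemma fourier_coef_trig (R : realType) (I : finType) (c : I -> R[i])
    (k : I -> int) (n : int) :
  fourier_coef (trig c k) n = \sum_i c i * (k i == n)%:R.
Proof.
have Eg x : trig c k x * conjc (expix n x) =
            \sum_i c i * expix (k i - n) x.
  rewrite /trig mulr_suml; apply: eq_bigr => i _.
  by rewrite expixD expixN mulrA.
rewrite /fourier_coef.
rewrite (Rintegral_harmonic_sum (k := fun i => k i - n)
           (a := fun i => complex.Re (c i)) (b := fun i => complex.Im (c i)));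
  last by move=> x; rewrite Eg Re_sum; apply: eq_bigr => i _; case: (c i).
rewrite (Rintegral_harmonic_sum (k := fun i => k i - n)
           (a := fun i => complex.Im (c i)) (b := fun i => - complex.Re (c i)));
  last first.
  move=> x; rewrite Eg Im_sum; apply: eq_bigr => i _.
  by rewrite /expix /harmonic; case: (c i) => u v /=; ring.
have pi2 : 2 * pi != 0 :> R by rewrite mulf_neq0 ?gt_eqF ?pi_gt0.
apply/eqP; rewrite eq_complex Re_sum Im_sum /=.
rewrite !mul0r subr0 addr0 !mulKf //.
apply/andP; split; apply/eqP/eq_bigr => i _; rewrite subr_eq0;
  by case: (c i) (_ == _) => u v [] /=; ring.
Qed.

(** The symmetric partial sums are constant as soon as K bounds all the
    frequencies, so the limit is that constant value. *)
Lemma L1_trig (R : realType) (I : finType) (c : I -> R[i]) (k : I -> int) :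
  L1 (trig c k) = trig (fun i => - `|k i|%:~R * c i) k.
Proof.
apply/funext => x; rewrite /L1.
apply: (@lim_near_cst R[i]^o); first exact: norm_hausdorff.
exists (\max_i `|k i|%N)%N => // K /= leK.
under eq_bigr => j _ do rewrite fourier_coef_trig mulr_sumr mulr_suml.
rewrite exchange_big /=; apply: eq_bigr => i _.
have kK : (`|k i| <= K)%N by apply: leq_trans leK; exact: leq_bigmax.
have jP : (absz (k i + K%:Z)%R < K.*2.+1)%N by lia.
rewrite (bigD1 (Ordinal jP)) //= big1 ?addr0.
  have -> : (absz (k i + K%:Z))%:Z - K%:Z = k i by lia.
  by rewrite eqxx mulr1.
move=> j; rewrite -val_eqE /= => jN.
have -> : (k i == j%:Z - K%:Z) = false by apply/eqP; lia.
by rewrite mulr0 mulr0 mul0r.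
Qed.

(** * The carre du champ and its iterate *)

Definition gamma_symbol (R : realType) (m n : int) : R[i] :=
  2^-1 * (`|m| + `|n| - `|m - n|)%:~R.

Lemma trigM_conj (R : realType) (I J : finType) (c : I -> R[i])
    (k : I -> int) (d : J -> R[i]) (l : J -> int) (x : R) :
  trig c k x * conjc (trig d l x) =
  trig (fun p : I * J => c p.1 * conjc (d p.2))
       (fun p : I * J => k p.1 - l p.2) x.
Proof.
rewrite /trig rmorph_sum big_distrlr /= pair_big; apply: eq_bigr => p _ /=.
by rewrite rmorphM /= expixD expixN mulrACA.
Qed.

Lemma Gamma_trig (R : realType) (I J : finType) (c : I -> R[i])
    (k : I -> int) (d : J -> R[i]) (l : J -> int) :
  Gamma (trig c k) (trig d l) =
  trig (fun p : I * J =>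
          c p.1 * conjc (d p.2) * gamma_symbol R (k p.1) (l p.2))
       (fun p : I * J => k p.1 - l p.2).
Proof.
apply/funext => x; rewrite /Gamma.
under eq_fun => y do rewrite trigM_conj.
rewrite -/(trig _ _) !L1_trig !trigM_conj /trig -!sumrB mulr_sumr.
apply: eq_bigr => p _; rewrite /gamma_symbol rmorphM /= rmorphN /= rmorph_int.
by ring.
Qed.

(** On the pair of frequencies (m, n), write w for the symbol of Gamma. Then
    the three terms of Gamma2 multiply w by - |m - n|, |n| and |m| respectively,
    and half their sum is w again: iterating Gamma squares the symbol. *)
Lemma Gamma2_trig (R : realType) (I : finType) (c : I -> R[i])
    (k : I -> int) :
  Gamma2 (trig c k) =
  trig (fun p : I * I =>
          c p.1 * conjc (c p.2) * gamma_symbol R (k p.1) (k p.2) ^+ 2)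
       (fun p : I * I => k p.1 - k p.2).
Proof.
apply/funext => x; rewrite /Gamma2 !L1_trig !Gamma_trig L1_trig.
rewrite /trig -!sumrB mulr_sumr.
apply: eq_bigr => p _; rewrite /gamma_symbol rmorphM /= rmorphN /= rmorph_int.
by ring.
Qed.

(** * The kernel min(m, n) and its square *)

Lemma half_absE (F : numFieldType) (m n : nat) :
  2^-1 * (m%:R + n%:R - `|m%:R - n%:R|) = (minn m n)%:R :> F.
Proof.
wlog le_mn : m n / (m <= n)%N => [H|].
  case/orP: (leq_total m n) => le; first exact: H.
  by rewrite distrC [m%:R + _]addrC minnC; exact: H.
rewrite distrC ger0_norm ?subr_ge0 ?ler_nat // (minn_idPl le_mn).
by field.
Qed.

Lemma gamma_symbol_nat (R : realType) (m n : nat) :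
  gamma_symbol R m%:Z n%:Z = (minn m n)%:R.
Proof.
by rewrite -half_absE /gamma_symbol intrB intrD !intr_norm intrB -!pmulrn
           !normr_nat.
Qed.

(** This identity is the source of the eigenvalues 1, 3, 5 and so on. *)
Lemma sum_odd (n : nat) : (\sum_(k < n) (2 * k + 1) = n ^ 2)%N.
Proof. by elim: n => [|n IH]; rewrite ?big_ord0 // big_ord_recr /= IH; lia. Qed.

(** Indices start at 0: k lies below both i and j exactly when k is less than
    min(i + 1, j + 1). *)
Lemma sum_below_min (T : pzSemiRingType) (N : nat) (i j : 'I_N)
    (w : nat -> nat) :
  \sum_(k < N) (w k)%:R * ((k <= i)%N%:R * (k <= j)%N%:R) =
  (\sum_(k < minn i.+1 j.+1) w k)%N%:R :> T.
Proof.
have le_mN : (minn i.+1 j.+1 <= N)%N by rewrite geq_min ltn_ord.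
rewrite (big_ord_widen _ _ le_mN) [in RHS]big_mkcond natr_sum /=.
apply: eq_bigr => k _; rewrite -natrM mulnb leq_min !ltnS.
by case: ifP => _; rewrite ?mulr1 ?mulr0.
Qed.

Lemma min_sum (T : pzSemiRingType) (N : nat) (i j : 'I_N) :
  (minn i.+1 j.+1)%:R =
  \sum_(k < N) 1 * ((k <= i)%N%:R * (k <= j)%N%:R) :> T.
Proof. by rewrite (sum_below_min _ _ _ (fun=> 1%N)) sum1_card card_ord. Qed.

Lemma min_sqr_sum (T : pzSemiRingType) (N : nat) (i j : 'I_N) :
  (minn i.+1 j.+1)%:R ^+ 2 =
  \sum_(k < N) (2 * k + 1)%:R * ((k <= i)%N%:R * (k <= j)%N%:R) :> T.
Proof.
by rewrite (sum_below_min _ _ _ (fun k => 2 * k + 1)%N) sum_odd natrX.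
Qed.

(** A kernel that is a combination of products of step functions turns the
    Hermitian form into a combination of squares. *)
Lemma hermitian_tail_sums (R : realType) (N : nat) (z q : 'I_N -> R[i]) :
  \sum_(p : 'I_N * 'I_N) z p.1 * conjc (z p.2) *
     (\sum_(k < N) q k * ((k <= p.1)%N%:R * (k <= p.2)%N%:R)) =
  \sum_(k < N) q k * `|\sum_(i < N | (k <= i)%N) z i| ^+ 2.
Proof.
under eq_bigr do rewrite mulr_sumr.
rewrite exchange_big /=; apply: eq_bigr => k _.
rewrite sqr_normc rmorph_sum big_distrlr /= pair_big_dep mulr_sumr.
rewrite [RHS]big_mkcond; apply: eq_bigr => p _ /=.
by rewrite -natrM mulnb; case: ifP => _; rewrite ?mulr0 // mulr1 mulrC.
Qed.

(** * The curvature *)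

(** Gamma and Gamma2 are diagonalized by the same tail sums, with weights 1 and
    2 k + 1 since k starts at 0: comparing them is comparing weights. *)
Lemma Gamma_plus (R : realType) (N : nat) (c : 'I_N -> R[i]) (x : R) :
  let f := trig c (fun i => i.+1%:Z) in
  let S k := \sum_(i < N | (k <= i)%N) c i * expix i.+1%:Z x in
  Gamma f f x = \sum_(k < N) 1 * `|S k| ^+ 2 /\
  Gamma2 f x = \sum_(k < N) (2 * k + 1)%:R * `|S k| ^+ 2.
Proof.
move=> f S; rewrite /f Gamma_trig Gamma2_trig /trig /S -!hermitian_tail_sums.
split; apply: eq_bigr => p _; rewrite gamma_symbol_nat.
  by rewrite min_sum expixD expixN rmorphM /=; ring.
by rewrite min_sqr_sum expixD expixN rmorphM /=; ring.
Qed.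

Lemma curvature_bound1 (R : realType) (N : nat) : curvature_bound N (1 : R).
Proof.
move=> _ [c ->] x; have [GE G2E] := Gamma_plus c x.
rewrite -/(trig c (fun i => i.+1%:Z)) GE G2E mul1r.
apply: ler_sum => k _; apply: ler_wpM2r; first by rewrite exprn_ge0.
by rewrite natrD lerDr ler0n.
Qed.

(** The bound is attained at [f = e^{ix}], for which Gamma and Gamma2 are both
    identically 1. *)
Lemma curvature_bound_le1 (R : realType) (N : nat) (k : R) :
  (0 < N)%N -> curvature_bound N k -> k <= 1.
Proof.
case: N => // N _ kN.
pose f : R -> R[i] := trig (fun _ : unit => 1) (fun=> 1).
have ff : trig_plus N.+1 f.
  exists (fun i => (i == ord0)%:R); apply/funext => x.
  rewrite big_ord_recl big1 ?addr0 => [|i _]; last by rewrite mul0r.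
  by rewrite /f /trig big_const card_unit /= addr0.
have := kN f ff 0; rewrite /f Gamma_trig Gamma2_trig /trig.
have c1 (z : unit * unit -> R[i]) : \sum_p z p = z (tt, tt).
  by rewrite (bigD1 (tt, tt)) //= big1 ?addr0 // => -[[] []].
rewrite !c1 (gamma_symbol_nat R 1 1) !expix_at0 conjc1 expr1n !mulr1.
by rewrite -(lecR k 1).
Qed.

(** * The quotient matrix *)

Lemma char_poly_trmx (F : comNzRingType) (n : nat) (B : 'M[F]_n) :
  char_poly B^T = char_poly B.
Proof.
rewrite /char_poly -det_tr; congr (\det _).
by apply/matrixP => i j; rewrite !mxE eq_sym.
Qed.

(** The roots of the characteristic polynomial of a triangular matrix are its
    diagonal entries; the transpose appears because [is_trig_mx] means lower
    triangular. *)
Lemma eigenvalue_upper_trig (F : fieldType) (n : nat) (B : 'M[F]_n) (a : F) :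
  (forall i j : 'I_n, (j < i)%N -> B i j = 0) ->
  eigenvalue B a <-> exists i, a = B i i.
Proof.
move=> Bu; rewrite eigenvalue_root_char -char_poly_trmx char_poly_trig.
  rewrite rootE horner_prod; split.
    move/prodf_eq0 => [i _]; rewrite hornerXsubC mxE subr_eq0 => /eqP ->.
    by exists i.
  move=> [i ->]; apply/prodf_eq0; exists i => //.
  by rewrite hornerXsubC mxE subrr.
by apply/is_trig_mxP => i j ij; rewrite mxE Bu.
Qed.

Definition step_mx (F : fieldType) (N : nat) : 'M[F]_N :=
  \matrix_(k, i) (k <= i)%N%:R.

(** The difference operator, inverse to the summation that [step_mx]
    performs. *)
Definition step_inv (F : fieldType) (N : nat) : 'M[F]_N :=
  \matrix_(i, k) ((k == i :> nat)%:R - (k == i.+1 :> nat)%:R).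

(** The vanishing of g from N on makes the formula valid for the last row,
    which has no superdiagonal entry. *)
Lemma mul_step_inv (F : fieldType) (N : nat) (i : 'I_N) (g : nat -> F) :
  (forall n, (N <= n)%N -> g n = 0) ->
  \sum_(k < N) step_inv F N i k * g k = g i - g i.+1.
Proof.
move=> g0; under eq_bigr do rewrite mxE mulrBl.
rewrite sumrB; congr (_ - _).
  rewrite (bigD1 i) //= eqxx mul1r big1 ?addr0 // => k ki.
  by rewrite -val_eqE in ki; rewrite (negbTE ki) mul0r.
case: (ltnP i.+1 N) => [lt_iN|le_Ni].
  rewrite (bigD1 (Ordinal lt_iN)) //= eqxx mul1r big1 ?addr0 // => k ki.
  by rewrite -val_eqE in ki; rewrite (negbTE ki) mul0r.
rewrite g0 // big1 // => k _.
by rewrite (ltn_eqF (leq_trans (ltn_ord k) le_Ni)) mul0r.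
Qed.

Lemma step_invK (F : fieldType) (N : nat) :
  step_inv F N *m step_mx F N = 1%:M.
Proof.
apply/matrixP => i j; rewrite !mxE.
under eq_bigr do rewrite [step_mx _ _ _ _]mxE.
rewrite (mul_step_inv i (g := fun k => (k <= j)%N%:R)) => [|n leNn].
  by rewrite -val_eqE /=; case: ltngtP => _; rewrite ?subrr ?subr0.
by rewrite leqNgt (leq_trans (ltn_ord j) leNn).
Qed.

Lemma Rhalf_minn (R : realType) (N : nat) (i j : 'I_N) :
  Rhalf R N i j = (minn i.+1 j.+1)%:R.
Proof. by rewrite mxE half_absE. Qed.

Lemma Rhalf_factor (R : realType) (N : nat) :
  Rhalf R N = (step_mx R N)^T *m step_mx R N.
Proof.
apply/matrixP => i j; rewrite Rhalf_minn min_sum mxE.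
by apply: eq_bigr => k _; rewrite !mxE mul1r.
Qed.

Lemma Rhalf_sqr_factor (R : realType) (N : nat) :
  hadamard_square (Rhalf R N) = (step_mx R N)^T *m
    (diag_mx (\row_(k < N) (2 * k + 1)%:R) *m step_mx R N).
Proof.
apply/matrixP => i j; rewrite mxE Rhalf_minn min_sqr_sum mxE.
by apply: eq_bigr => k _; rewrite mul_diag_mx !mxE mulrCA.
Qed.

Lemma step_mx_unit (F : fieldType) (N : nat) : step_mx F N \in unitmx.
Proof. by have [] := mulmx1_unit (step_invK F N). Qed.

Lemma Rhalf_unit (R : realType) (N : nat) : Rhalf R N \in unitmx.
Proof. by rewrite Rhalf_factor unitmx_mul unitmx_tr step_mx_unit. Qed.

(** Write U for the upper triangular step matrix and D for the diagonal matrix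
    of the odd numbers. As the kernel is [U^T U] and its entrywise square is
    [U^T D U], the factor [U^T] cancels and the quotient is [U^-1 D U]; the
    difference operator [U^-1] then gives each entry as a difference of two
    entries of [D U]. *)
Lemma Rhalf_quotient (R : realType) (N : nat) (i j : 'I_N) :
  (invmx (Rhalf R N) *m hadamard_square (Rhalf R N)) i j =
  (2 * i + 1)%:R * (i <= j)%N%:R - (2 * i.+1 + 1)%:R * (i < j)%N%:R.
Proof.
have -> : invmx (Rhalf R N) *m hadamard_square (Rhalf R N) =
  step_inv R N *m (diag_mx (\row_(k < N) (2 * k + 1)%:R) *m step_mx R N).
  apply: (can_inj (mulKmx (Rhalf_unit R N))).
  rewrite mulKVmx ?Rhalf_unit // Rhalf_sqr_factor Rhalf_factor.
  rewrite -!mulmxA; congr (_ *m _).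
  by rewrite [RHS]mulmxA (mulmx1C (step_invK R N)) mul1mx.
rewrite mxE.
under eq_bigr => k _ do
  rewrite mul_diag_mx 2![in X in _ * X]mxE [step_mx _ _ _ _]mxE.
pose g k : R := (2 * k + 1)%:R * (k <= j)%N%:R.
rewrite (mul_step_inv i (g := g)) // => n leNn.
by rewrite /g leqNgt (leq_trans (ltn_ord j) leNn) mulr0.
Qed.

Theorem theoremC (R : realType) (N : nat) (hN : (1 <= N)%N) :
  let A : 'M[R]_N := Rhalf R N in
  let B : 'M[R]_N := invmx A *m hadamard_square A in
  (forall i j : 'I_N, A i j = (minn i.+1 j.+1)%:R) /\
  A \in unitmx /\
  (forall i j : 'I_N, (j < i)%N -> B i j = 0) /\
  (forall a : R, eigenvalue B a <-> exists i : 'I_N, a = (2 * i + 1)%:R) /\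
  is_curvature N (1 : R).
Proof.
move=> A B.
have Bu (i j : 'I_N) : (j < i)%N -> B i j = 0.
  move=> ji; rewrite Rhalf_quotient leqNgt ji ltnNge (ltnW ji) /=.
  by rewrite !mulr0 subr0.
have Bd (i : 'I_N) : B i i = (2 * i + 1)%:R.
  by rewrite Rhalf_quotient leqnn ltnn mulr1 mulr0 subr0.
split; [exact: Rhalf_minn | split; [exact: Rhalf_unit | split=> //]].
split=> [a|].
  rewrite (eigenvalue_upper_trig _ Bu).
  by split=> -[i ->]; exists i; rewrite Bd.
split=> [|k]; [exact: curvature_bound1 | exact: curvature_bound_le1].
Qed.
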